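(* Let $\mu$ and $\nu$ be finite Borel measures on a complete separable metric space $Z$. (i) For $\epsilon\ge0$, $d_P(\mu,\nu)\le\epsilon$ if and only if there is a Borel measure $\alpha$ on $Z\times Z$ such that $D(\alpha;\mu,\nu)+\alpha(\{(x,y):d(x,y)>\epsilon\})\le\epsilon$. (ii) Equivalently, $d_P(\mu,\nu)=\min\{\epsilon\ge0:\exists\alpha:\ D(\alpha;\mu,\nu)+\alpha(\{(x,y):d(x,y)>\epsilon\})\le\epsilon\}$, and the minimum is attained. (iii) In addition, if $\mu(Z)\le\nu(Z)$, then the minimum in (ii) is attained for $\epsilon:=d_P(\mu,\nu)$ and some $\alpha$ with $\pi_{1*}\alpha=\mu$ and $\pi_{2*}\alpha\le\nu$; moreover $\alpha$ can be chosen to be supported on $\mathrm{supp}(\mu)\times\mathrm{supp}(\nu)$.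
   Context: For a closed set $A\subseteq Z$ and $\epsilon\ge0$, $A^\epsilon=\{z\in Z:\exists a\in A,\ d(z,a)\le\epsilon\}$. The Prokhorov distance is $d_P(\mu,\nu)=\inf\{\epsilon>0: \mu(A)\le\nu(A^\epsilon)+\epsilon \text{ and } \nu(A)\le\mu(A^\epsilon)+\epsilon \text{ for all closed } A\subseteq Z\}$. $\pi_1,\pi_2$ are the projections of $Z\times Z$ onto its factors and $f_*$ denotes push-forward. The total variation distance of measures is $\|\mu-\nu\|_{TV}=\sup_A|\mu(A)-\nu(A)|$ over Borel sets $A$. For a finite Borel measure $\alpha$ on $Z\times Z$, the discrepancy is $D(\alpha;\mu,\nu):=\|\pi_{1*}\alpha-\mu\|_{TV}+\|\pi_{2*}\alpha-\nu\|_{TV}$. *)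

(* Defs.v *)
From HB Require Import structures.
From mathcomp Require Import all_boot all_order all_algebra.
From mathcomp Require Import all_classical all_reals all_analysis.
Set Implicit Arguments. Unset Strict Implicit. Unset Printing Implicit Defensive.
Import Order.TTheory GRing.Theory Num.Theory.
Local Open Scope classical_set_scope.
Local Open Scope ring_scope.

(* A complete metric space with a distinguished point (mathcomp-analysis
   measurable types are always pointed, i.e. nonempty). *)
#[short(type="pointedCompleteMetricType")]
HB.structure Definition PointedCompleteMetric (K : numDomainType) :=
  { M of Pointed M & Metric K M & Complete M }.

Notation borel Z := (g_sigma_algebraType (@open Z)).

Local Open Scope ereal_scope.

Definition tv_dist {R : realType} d (T : measurableType d)
    (m1 m2 : set T -> \bar R) : \bar R :=
  ereal_sup [set `| m1 A - m2 A | | A in [set A : set T | measurable A]].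

Definition discrepancy {R : realType} (Z : pointedCompleteMetricType R)
    (alpha : set (borel Z * borel Z)%type -> \bar R)
    (mu nu : set (borel Z) -> \bar R) : \bar R :=
  tv_dist (pushforward alpha fst) mu + tv_dist (pushforward alpha snd) nu.

Definition enlargement {R : realType} (Z : pointedCompleteMetricType R)
    (A : set Z) (e : R) : set Z :=
  [set z | exists2 a, A a & (@mdist R Z z a <= e)%R].

(* Outer measure induced by a measure (agrees with the measure on measurable
   sets); used to evaluate mu(A^eps), since A^eps need not be Borel. *)
Definition outer_meas {R : realType} d (T : measurableType d)
    (m : set T -> \bar R) (S : set T) : \bar R :=
  ereal_inf [set m B | B in [set B : set T | measurable B /\ S `<=` B]].

Definition prokhorov {R : realType} (Z : pointedCompleteMetricType R)
    (mu nu : set (borel Z) -> \bar R) : \bar R :=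
  ereal_inf [set e%:E | e in [set e : R | (0 < e)%R /\
    forall A : set Z, closed A ->
      mu A <= outer_meas nu (enlargement A e) + e%:E /\
      nu A <= outer_meas mu (enlargement A e) + e%:E]].

Definition msupport {R : realType} (Z : pointedCompleteMetricType R)
    (mu : set (borel Z) -> \bar R) : set Z :=
  [set x | forall U : set Z, open U -> U x -> 0 < mu U].

Definition far_pairs {R : realType} (Z : pointedCompleteMetricType R) (e : R)
  : set (borel Z * borel Z)%type :=
  [set p | (e < @mdist R Z p.1 p.2)%R].
Arguments far_pairs {R} Z e.

(* Main.v *)
(** Strassen's theorem by duality, without discretisation. Assume mu(Z) <= nu(Z) and
    d_P(mu, nu) <= e. Continuity of mu along the open thickenings of a compact K gives
    nu(K) <= mu(K^e) + e. On the simple functions h on Z x Z consider the sublinear functional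
      p(h) = inf { int f dmu + int g dnu : g >= 0, h(x, y) <= f(x) + g(y) }.
    Comparing level sets of f and g, and using inner regularity by compact sets, the compact
    inequality yields p(1_{d <= e}) >= nu(Z) - e. Hahn-Banach produces an additive functional
    below p attaining p at 1_{d <= e}, that is, a finitely additive coupling with first
    marginal mu and second marginal at most nu. On rectangles it is countably additive because
    its marginals are tight and outer regular, so it extends to a measure alpha; since
    {d > e} is a countable union of rectangles, alpha(d > e) <= mu(Z) - (nu(Z) - e), and the
    discrepancy of alpha is nu(Z) - mu(Z). *)

Require Import Defs.
From HB Require Import structures.
From mathcomp Require Import all_boot all_order all_algebra.
From mathcomp Require Import all_classical all_reals all_analysis.
From mathcomp Require Import lra.
Import Order.TTheory GRing.Theory Num.Theory HBSimple.
Local Open Scope classical_set_scope.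
Local Open Scope ring_scope.

(** * Hahn-Banach for additive functionals *)

Section hahn_banach.
Context (R : realType) (V : zmodType).
Implicit Types (p q : V -> R) (x y : V).

(** In an abelian group only natural multiples are available, so homogeneity is asked for these, and
    only in one direction; equality is recovered in [sublinear_mulrn]. *)
Definition sublinear q :=
  (forall x y, q (x + y) <= q x + q y) /\
  (forall x n, q x *+ n <= q (x *+ n)).

Lemma sublinear0 q : sublinear q -> q 0 = 0.
Proof.
move=> [qD qM]; apply/eqP; rewrite eq_le; apply/andP; split.
  by have := qM 0 2%N; rewrite mul0rn mulr2n; lra.
by have := qD 0 0; rewrite addr0; lra.
Qed.

Lemma sublinear_mulrn q x n : sublinear q -> q (x *+ n) = q x *+ n.
Proof.
move=> sq; apply/eqP; rewrite eq_le (proj2 sq) andbT.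
elim: n => [|n ih]; first by rewrite !mulr0n sublinear0.
by rewrite !mulrS (le_trans (proj1 sq _ _))// lerD2l.
Qed.

Lemma sublinear_ge q x : sublinear q -> - q (- x) <= q x.
Proof.
move=> sq; have := proj1 sq x (- x); rewrite subrr sublinear0//; lra.
Qed.

(** Take [q' x = inf_n (q (x + n y) - n q y)], which is finite because every term is at least
    [- q (- x)]. The term [n = 0] gives [q' <= q]; the term [n = 1] at [- y] gives the last
    bound. *)
Lemma sublinear_descent q y : sublinear q ->
  exists q', [/\ sublinear q', forall x, q' x <= q x & q' (- y) <= - q y].
Proof.
move=> sq; have [qD qM] := sq.
pose a x n : R := q (x + y *+ n) - q y *+ n.
pose q' x := inf (range (a x)).
have aB x n : - q (- x) <= a x n.
  have := qD (x + y *+ n) (- x); rewrite addrAC subrr add0r sublinear_mulrn// /a.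
  lra.
have hlb x : has_lbound (range (a x)) by exists (- q (- x)) => _ [n _ <-].
have q'a x n : q' x <= a x n by apply: ge_inf => //; exists n.
have q'P x c : (forall n, c <= a x n) -> c <= q' x.
  by move=> h; apply: lb_le_inf; [exists (a x 0%N); exists 0%N|move=> _ [n _ <-]].
exists q'; split.
- split=> [x x'|x k].
  + rewrite -lerBlDl; apply: (q'P) => m; rewrite lerBlDl -lerBlDr; apply: q'P => n.
    rewrite lerBlDr (le_trans (q'a _ (n + m)%N))// /a !mulrnDr.
    by have := qD (x + y *+ n) (x' + y *+ m); rewrite addrACA; lra.
  + apply: q'P => n; case: k => [|k].
      by rewrite !mulr0n /a add0r sublinear_mulrn// subrr.
    (* Of the [(k + 1) n] copies of [y], all but [n] are split off by subadditivity, at a cost of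
       exactly [q y] each. *)
    apply: (@le_trans _ _ (a x n *+ k.+1)); first by rewrite ler_wMn2r.
    rewrite /a mulrnBl -(sublinear_mulrn q (x + y *+ n))// mulrnDl -!mulrnA.
    have -> : (n * k.+1 = n + n * k)%N by rewrite mulnS.
    have := qD (x *+ k.+1 + y *+ n) (y *+ (n * k)).
    by rewrite sublinear_mulrn// -addrA -mulrnDr mulrnDr; lra.
- by move=> x; rewrite (le_trans (q'a _ 0%N))// /a !mulr0n addr0 subr0.
- by rewrite (le_trans (q'a _ 1%N))// /a !mulr1n addNr sublinear0// sub0r.
Qed.

(** Zorn's lemma: the pointwise infimum of a chain is again sublinear, and it is finite because
    [- p (- x)] bounds all members from below. *)
Lemma sublinear_minimal p : sublinear p ->
  exists q, [/\ sublinear q, forall x, q x <= p x &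
    forall q', sublinear q' -> (forall x, q' x <= q x) -> q' = q].
Proof.
move=> sp; pose T := {q | sublinear q /\ forall x, q x <= p x}.
(* The order is reversed, so that a maximal element is a minimal functional. *)
pose below : rel T := fun s t => `[< forall x, sval t x <= sval s x >].
have t0 : T by exists p.
have [||A Atot|[q [sq qp]] qmin] := @ZL_preorder T t0 below.
- by move=> t; apply/asboolP.
- move=> r s t /asboolP rs /asboolP st; apply/asboolP => x.
  exact: le_trans (st x) (rs x).
- have [[t At]|A0] := pselect (A !=set0); last first.
    by exists t0 => s As; exfalso; apply: A0; exists s.
  pose q x := inf [set sval s x | s in A].
  have hlb x : has_lbound [set sval s x | s in A].
    exists (- p (- x)) => _ [[s [ss sp']] _ <-]/=.
    by rewrite (le_trans _ (sublinear_ge s x ss))// lerN2.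
  have qle x s : A s -> q x <= sval s x by move=> As; apply: ge_inf => //; exists s.
  have qP x c : (forall s, A s -> c <= sval s x) -> c <= q x.
    move=> h; apply: lb_le_inf; first by exists (sval t x); exists t.
    by move=> _ [s As <-]; exact: h.
  have sq : sublinear q.
    split=> [x x'|x n].
    + rewrite -lerBlDl; apply: (qP) => s As; rewrite lerBlDl -lerBlDr; apply: qP => r Ar.
      (* Two members of the chain are comparable; the smaller one serves for both arguments. *)
      rewrite lerBlDr; have [/asboolP h|/asboolP h] := Atot _ _ As Ar.
      * rewrite (le_trans (qle _ _ Ar))// (le_trans (proj1 (proj1 (svalP r)) _ _))//.
        by rewrite lerD2l h.
      * rewrite (le_trans (qle _ _ As))// (le_trans (proj1 (proj1 (svalP s)) _ _))//.
        by rewrite lerD2r h.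
    + apply: qP => s As; rewrite (le_trans _ (proj2 (proj1 (svalP s)) _ _))//.
      by rewrite ler_wMn2r// qle.
  have qp x : q x <= p x by rewrite (le_trans (qle _ _ At))// (proj2 (svalP t)).
  by exists (exist _ q (conj sq qp)) => s As; apply/asboolP => x; exact: qle.
exists q; split=> // q' sq' q'q; apply/funext => x; apply/eqP; rewrite eq_le q'q/=.
have q'p y : q' y <= p y by rewrite (le_trans (q'q y)).
have := qmin (exist _ q' (conj sq' q'p)); rewrite /below/= => h.
by have /asboolP := h (introT (asboolP _) q'q); exact.
Qed.

(* Additivity of a minimal sublinear functional [q]: descending along [y] cannot
   lower [q], so [q (- y) <= - q y]. *)
Lemma hahn_banach_additive p v : sublinear p ->
  exists L : V -> R, [/\ forall x y, L (x + y) = L x + L y,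
    forall x, L x <= p x & L v = p v].
Proof.
(* Descending along [v] before minimising secures [p' (- v) <= - p v]; once [q] is odd, this yields
   [q v >= p v]. *)
move=> sp; have [p' [sp' p'p p'v]] := sublinear_descent p v sp.
have [q [sq qp' qmin]] := sublinear_minimal p' sp'.
have qN y : q (- y) = - q y.
  apply/eqP; rewrite eq_le; apply/andP; split; last first.
    by have := sublinear_ge q y sq; lra.
  by have [q' [sq' q'q q'y]] := sublinear_descent q y sq; rewrite (qmin q') // in q'y.
have qp x : q x <= p x by rewrite (le_trans (qp' x)).
exists q; split=> // [x y|].
  apply/eqP; rewrite eq_le (proj1 sq)/=.
  by have := proj1 sq (x + y) (- y); rewrite addrK qN; lra.
apply/eqP; rewrite eq_le qp/=.
by have := qp' (- v); rewrite qN; lra.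
Qed.

End hahn_banach.

(** * Regularity of finite Borel measures *)

(* The ascription makes the values live in [R] itself rather than in [R] seen
   through its [numDomainType] structure, which [lra] does not identify. *)
Definition rdist {R : realType} {Z : pointedCompleteMetricType R} (x y : Z) : R :=
  @mdist R Z x y.

(** * Borel sets and thickenings in a metric space *)

Section metric_borel.
Context (R : realType) (Z : pointedCompleteMetricType R).
Local Notation dist := (@rdist R Z).
Implicit Types (A K F U : set Z).

Lemma rdist_sym (x y : Z) : dist x y = dist y x.
Proof. exact: metric_sym. Qed.

Lemma rdist_triangle (x y z : Z) : dist x z <= dist x y + dist y z.
Proof. exact: metric_triangle. Qed.

Lemma rdistxx (x : Z) : dist x x = 0.
Proof. exact: mdistxx. Qed.

Lemma rball (x y : Z) (r : R) : ball x r y = (dist x y < r).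
Proof. by rewrite ballEmdist. Qed.

Lemma measurable_open U : open U -> measurable (U : set (borel Z)).
Proof. exact: sub_sigma_algebra. Qed.

Lemma measurable_closed F : closed F -> measurable (F : set (borel Z)).
Proof.
by move=> cF; rewrite -[F]setCK; apply: measurableC; apply: measurable_open; rewrite openC.
Qed.

Lemma measurable_compact K : compact K -> measurable (K : set (borel Z)).
Proof.
by move=> cK; apply: measurable_closed; apply: compact_closed cK; exact: (@metric_hausdorff R Z).
Qed.

Lemma open_metricP U :
  open U <-> forall x, U x -> exists2 r : R, 0 < r & forall y, dist x y < r -> U y.
Proof.
rewrite openE; split=> h x Ux.
  have /metricType_numDomainType.nbhs_mdistP[r r0 rU] := h x Ux.
  by exists r => // y xy; apply: rU.
rewrite /interior -filter_from_ballE; have [r r0 rU] := h x Ux.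
by exists r => // y; rewrite rball => /rU.
Qed.

Lemma closure_dist A x (r : R) : closure A x -> 0 < r -> exists2 a, A a & dist x a < r.
Proof.
move=> /(_ (ball x r) (nbhsx_ballx x r _)) h r0; have [a [Aa]] := h r0.
by rewrite rball => xa; exists a.
Qed.

Lemma open_rdist_gt (x : Z) (c : R) : open [set y : Z | c < dist x y].
Proof.
apply/open_metricP => a /= ax; exists (dist x a - c); first by rewrite subr_gt0.
move=> y ay; have := rdist_triangle x y a.
by rewrite (rdist_sym y a); lra.
Qed.

(** The strict inequality makes this set open, hence Borel, whatever [A] is. *)
Definition thickening A (r : R) : set Z := [set z | exists2 a, A a & dist z a < r].

Lemma open_thickening A r : open (thickening A r).
Proof.
apply/open_metricP => x [a Aa xa]; exists (r - dist x a); first by rewrite subr_gt0.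
move=> y xy; exists a => //; rewrite (le_lt_trans (rdist_triangle y x a))//.
by rewrite (rdist_sym y x); lra.
Qed.

Lemma thickening_le A r s : r <= s -> thickening A r `<=` thickening A s.
Proof. by move=> rs x [a Aa xa]; exists a => //; exact: lt_le_trans rs. Qed.

Lemma bigcap_thickening_closed F : closed F ->
  \bigcap_n thickening F (n.+1%:R^-1) = F.
Proof.
move=> cF; apply/seteqP; split=> [x xF|x Fx n _]; last first.
  by exists x => //; rewrite rdistxx invr_gt0.
apply: cF => B; rewrite -filter_from_ballE => -[r r0 rB].
have [n nr] : exists n, n.+1%:R^-1 < r.
  by have [n _ nr] := near_infty_natSinv_lt (PosNum r0); exists n; apply: nr => /=.
have [a Fa xa] := xF n I; exists a; split=> //; apply: rB.
by rewrite rball; exact: lt_trans nr.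
Qed.

(** If no point of [K] is within [e] of [x], the increasing open sets [U n] cover [K]. A finite
    subcover puts [K] inside a single one, which contradicts membership of [x] in the thickening of
    index [N]. *)
Lemma bigcap_thickening_compact K (e : R) : compact K ->
  \bigcap_n thickening K (e + n.+1%:R^-1) = enlargement K e.
Proof.
move=> cK; apply/seteqP; split=> [x xK|x [a Ka xa] n _]; last first.
  by exists a => //; rewrite (le_lt_trans xa)// ltrDl invr_gt0.
apply: contrapT => nK.
pose U (n : nat) : set Z := [set a | e + n.+1%:R^-1 < dist x a].
have oU n : open (U n) by exact: open_rdist_gt.
move: cK; rewrite compact_cover => /(_ nat setT U (fun n _ => oU n)).
have KU : K `<=` cover setT U.
  move=> a Ka; have ea : e < dist x a.
    by rewrite ltNge; apply/negP => h; apply: nK; exists a.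
  have ea0 : 0 < dist x a - e by rewrite subr_gt0.
  have [n _ nr] := near_infty_natSinv_lt (PosNum ea0).
  by exists n => //; rewrite /U/= -ltrBrDl; exact: nr n (leqnn n).
move=> /(_ KU)[D _ KD]; pose N := (\max_(i <- finmap.enum_fset D) i)%N.
have [a Ka xa] := xK N I.
have [i iD] := KD _ Ka; rewrite /U/= => /(lt_trans)/(_ xa); apply/negP.
rewrite -leNgt lerD2l lef_pV2 ?posrE// ler_nat ltnS.
by apply: leq_bigmax_seq.
Qed.

End metric_borel.

Section nonincreasing_measure.
Context d (T : measurableType d) (R : realType).

(** Continuity from above, in the form that picks a stage whose measure is already below a given
    bound. *)
Lemma nonincreasing_measure_lt (m : {finite_measure set T -> \bar R})
    (F : (set T)^nat) (x : \bar R) :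
  (forall n, measurable (F n)) -> nonincreasing_seq F ->
  (m (\bigcap_n F n) < x)%E -> exists n, (m (F n) < x)%E.
Proof.
move=> mF dF mx.
have h := @nonincreasing_cvg_mu _ _ _ m F _ mF (bigcap_measurableType (fun n _ => mF n)) dF.
have m0 : (m (F 0%N) < +oo)%E by rewrite ltey_eq fin_num_measure.
have [|n _ nx] := h m0 [set y | (y < x)%E].
  by apply: open_nbhs_nbhs; split => //; exact: open_ereal_lt_ereal.
by exists n; apply: (nx n) => /=.
Qed.

End nonincreasing_measure.

(** * Approximation by closed, open and compact sets *)

Section regularity.
Context (R : realType) (Z : pointedCompleteMetricType R).
Local Notation dist := (@rdist R Z).
Implicit Types (m : {finite_measure set (borel Z) -> \bar R}) (A : set (borel Z)).
Local Open Scope ereal_scope.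

(** The points of [U] closer than [1/(n+1)] to the closed complement form strips that decrease to
    the empty set; [F] is what remains outside one of them. *)
Let open_regular m (U : set Z) (e : R) : open U -> (0 < e)%R ->
  exists F : set Z, [/\ closed F, F `<=` U & m (U `\` F) < e%:E].
Proof.
move=> oU e0; have cU : closed (~` U) by rewrite closedC.
pose S n : set (borel Z) := U `&` thickening R Z (~` U) n.+1%:R^-1.
have [|||n Sn] := @nonincreasing_measure_lt _ _ _ m S e%:E.
- move=> n; apply: measurableI; first exact: measurable_open.
  by apply: measurable_open; exact: open_thickening.
- move=> i j ij; apply/subsetPset => x [Ux xt]; split => //.
  by apply: thickening_le xt; rewrite lef_pV2 ?posrE// ler_nat.
- rewrite (_ : \bigcap_n S n = set0) ?measure0//.
  apply/seteqP; split => // x xS; have [Ux _] := xS 0%N I.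
  suff : (~` U) x by [].
  by rewrite -(bigcap_thickening_closed _ _ _ cU) => n _; have [] := xS n I.
exists (~` thickening R Z (~` U) n.+1%:R^-1); split.
- by rewrite closedC; exact: open_thickening.
- move=> x; apply: contra_notP => Ux; exists x => //.
  by rewrite rdistxx invr_gt0.
- by rewrite setDE setCK.
Qed.

(** The sets with this property form a sigma-algebra that contains the open sets. *)
Lemma closed_open_regular m A (e : R) : measurable A -> (0 < e)%R ->
  exists F U : set Z, [/\ closed F, open U, F `<=` A, A `<=` U &
    m (U `\` F) < e%:E].
Proof.
pose G : set_system (borel Z) := [set A | forall e : R, (0 < e)%R ->
  exists F U : set Z, [/\ closed F, open U, F `<=` A, A `<=` U & m (U `\` F) < e%:E]].
suff h : @measurable _ (borel Z) `<=` G by move=> /h; exact.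
apply: smallest_sub; last first.
  move=> U oU r r0; have [F [cF FU mF]] := open_regular m U r oU r0.
  by exists F, U; split.
split=> [r r0|B GB r r0|B GB r r0].
- exists set0, set0; split=> //; [exact: closed0|exact: open0|].
  by rewrite setDv measure0.
- have [F [U [cF oU FB BU mUF]]] := GB r r0.
  exists (~` U), (~` F); split; [by rewrite closedC|by rewrite openC| | |].
  + by rewrite setTD; exact: subsetC.
  + by rewrite setTD; exact: subsetC.
  + by rewrite setDE setCK setIC.
- have r2 n : (0 < r / 2 / (2 ^ n.+1)%:R)%R by rewrite !divr_gt0// ltr0n expn_gt0.
  have /choice[FU FUP] n : exists FU : set Z * set Z, [/\ closed FU.1, open FU.2,
      FU.1 `<=` B n, B n `<=` FU.2 & m (FU.2 `\` FU.1) < (r / 2 / (2 ^ n.+1)%:R)%:E].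
    by have [F [U FUP]] := GB n _ (r2 n); exists (F, U).
  pose F n := (FU n).1; pose U n := (FU n).2.
  have cF n : closed (F n) by have [] := FUP n.
  have oU n : open (U n) by have [] := FUP n.
  have mF n : measurable (F n : set (borel Z)) by exact: measurable_closed.
  have mU n : measurable (U n : set (borel Z)) by exact: measurable_open.
  have oUU : open (\bigcup_n U n) by apply: bigcup_open => n _; exact: oU.
  have mUU : measurable (\bigcup_n U n : set (borel Z)) by exact: measurable_open.
  (* The union of all [F i] need not be closed, so it is truncated. The errors sum to at most
     [r / 2], and the remaining room up to [r] absorbs the truncation by continuity from above. *)
  pose H n := \big[setU/set0]_(i < n) F i.
  have cH n : closed (H n) by rewrite /H; apply: closed_bigsetU => i _.
  pose S n : set (borel Z) := \bigcup_n U n `\` H n.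
  have [|||n Sn] := @nonincreasing_measure_lt _ _ _ m S r%:E.
  + by move=> n; apply: measurableD => //; exact: measurable_closed.
  + move=> i j ij; apply/subsetPset => x [Ux xt]; split => // xi; apply: xt.
    exact: (subset_bigsetU ij).
  + apply: (@le_lt_trans _ _ (r / 2)%:E); last by rewrite lte_fin gtr_pMr// invf_lt1// ltr1n.
    apply: (@le_trans _ _ (\sum_(0 <= n <oo) m (U n `\` F n))).
      apply: measure_sigma_subadditive.
      * by move=> n; exact: measurableD.
      * apply: bigcap_measurableType => n _.
        by apply: measurableD => //; exact: measurable_closed.
      * move=> x xS; have [[k _ Uk] _] := xS 0%N I.
        exists k => //; split => // Fk; have [_] := xS k.+1 I; apply.
        by rewrite /H big_ord_recr/=; right.
    apply: le_trans (@epsilon_trick0 R (r / 2) xpredT _); last by rewrite divr_ge0// ltW.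
    by apply: lee_nneseries => // n _; apply/ltW; have [] := FUP n.
  exists (H n), (\bigcup_n U n); split => //.
  + rewrite /H -bigcup_mkord => x [k _ Fk]; exists k => //.
    by have [_ _ FB _ _] := FUP k; exact: FB.
  + move=> x [k _ Bk]; exists k => //.
    by have [_ _ _ BU _] := FUP k; exact: BU.
Qed.

(** An ultrafilter on [K] must contain a member of every finite cover by balls, so it is Cauchy;
    completeness gives a limit and closedness puts it in [K]. *)
Lemma totally_bounded_compact (K : set Z) : closed K ->
  (forall r : R, (0 < r)%R -> exists s : seq Z, forall x, K x ->
     exists2 a, a \in s & (dist a x < r)%R) -> compact K.
Proof.
move=> cK tb; rewrite compact_ultra => F FU FK.
have cF : cauchy F.
  apply: cauchy_exP => r r0; have [s sK] := tb r r0; apply: contrapT => nF.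
  have : F (K `&` \bigcap_(a in [set` s]) ~` ball a r).
    apply: filterI => //; elim: s {sK} => [|a s ih].
      by apply: filterS filterT => x _ b.
    have [Fa|Fa] := in_ultra_setVsetC (ball a r) FU.
      by exfalso; apply: nF; exists a.
    apply: filterS (filterI Fa ih) => x [ax xs] b /=.
    by rewrite inE => /orP[/eqP->//|]; exact: xs.
  move/filter_ex => [x [Kx xs]]; have [a as_ ax] := sK _ Kx.
  by apply: (xs a as_); rewrite rball.
have /cauchy_cvgP/cvg_ex[l Fl] := cF.
exists l; split=> //=; apply: cK => B /Fl FB.
by apply: (@filter_ex _ F) => //; exact: filterI.
Qed.

Hypothesis Zsep : exists D : set Z, countable D /\ dense D.

Lemma dense_seq : exists u : nat -> Z, forall x (r : R), (0 < r)%R ->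
  exists n, (dist (u n) x < r)%R.
Proof.
have [D [cD dD]] := Zsep.
have DP x (r : R) : (0 < r)%R -> exists2 a, D a & (dist a x < r)%R.
  move=> r0; have [||y [/= [a -> ya] Dy]] := dD (thickening R Z [set x] r).
  - by exists x; exists x => //; rewrite rdistxx.
  - exact: open_thickening.
  - by exists y.
(* The distinguished point makes [D] nonempty, which an enumeration by all of [nat] requires. *)
have [d0 Dd0 _] := DP point 1%R ltr01.
have /pfcard_geP[D0|[u]] := cD; first by rewrite D0 in Dd0.
exists u => x r r0; have [a Da ax] := DP x r r0.
by have [n _ nE] := @surj _ _ _ _ u _ Da; exists n; rewrite nE.
Qed.

(** Ulam's argument: at each scale [1/(k+1)], finitely many balls around dense points miss mass less
    than [e / 2^(k+1)]. The intersection over [k] of the closures of these finite unions is closed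
    and totally bounded. *)
Lemma tight m (e : R) : (0 < e)%R -> exists2 K : set Z, compact K & m (~` K) <= e%:E.
Proof.
move=> e0; have [u uP] := dense_seq.
pose W k i : set Z := thickening R Z [set u i] k.+1%:R^-1.
pose B k n : set Z := \big[setU/set0]_(i < n) W k i.
have oB k n : open (B k n).
  rewrite /B; elim/big_ind: _ => [|? ? ? ?|i _]; [exact: open0|exact: openU|].
  exact: open_thickening.
have /choice[N NP] k : exists n, m (~` B k n) < (e / (2 ^ k.+1)%:R)%:E.
  apply: (@nonincreasing_measure_lt _ _ _ m (fun n => ~` B k n)).
  - by move=> n; apply: measurable_closed; rewrite closedC.
  - move=> i j ij; apply/subsetPset => x /= xj xi; apply: xj. exact: (subset_bigsetU ij).
  - rewrite (_ : \bigcap_n _ = set0) ?measure0 ?lte_fin ?divr_gt0 ?ltr0n ?expn_gt0//.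
    apply/seteqP; split => // x xB.
    have [|n xn] := uP x (k.+1%:R^-1)%R; first by rewrite invr_gt0.
    have := xB n.+1 I; apply; rewrite /B big_ord_recr/=; right.
    by exists (u n) => //; rewrite rdist_sym.
pose K := \bigcap_k closure (B k (N k)).
have cK : closed K by apply: closed_bigI => k _; exact: closed_closure.
exists K.
  apply: totally_bounded_compact => // r r0.
  (* One half of [r] pays for the closure, the other for the radius of the balls. *)
  have r20 : (0 < r / 2)%R by rewrite divr_gt0.
  have [k _ kr] := near_infty_natSinv_lt (PosNum r20).
  have {}kr : (k.+1%:R^-1 < r / 2)%R := kr k (leqnn k).
  exists [seq u i | i <- iota 0 (N k)] => x Kx.
  have [y yB xy] := closure_dist _ _ _ _ _ (Kx k I) r20.
  move: yB; rewrite /B -bigcup_mkord => -[i /= iN [_ -> yu]].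
  exists (u i); first by apply/mapP; exists i => //; rewrite mem_iota.
  have := rdist_triangle _ _ (u i) y x; rewrite (rdist_sym _ _ (u i) y) (rdist_sym _ _ y x).
  by move: (k.+1%:R^-1)%R yu kr => c; lra.
apply: (@le_trans _ _ (\sum_(0 <= k <oo) m (~` closure (B k (N k))))).
  apply: measure_sigma_subadditive.
  - by move=> k; apply: measurable_open; rewrite openC; exact: closed_closure.
  - by apply: measurable_open; rewrite openC.
  - by rewrite setC_bigcap.
apply: le_trans (@epsilon_trick0 R e xpredT (ltW e0)).
apply: lee_nneseries => // k _; apply: le_trans (ltW (NP k)).
apply: le_measure; rewrite ?inE.
- by apply: measurable_open; rewrite openC; exact: closed_closure.
- by apply: measurable_closed; rewrite closedC.
- by apply: subsetC; exact: subset_closure.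
Qed.

Lemma compact_inner_regular m A (e : R) : measurable A -> (0 < e)%R ->
  exists2 K : set Z, compact K & K `<=` A /\ m (A `\` K) < e%:E.
Proof.
move=> mA e0; have e20 : (0 < e / 2)%R by rewrite divr_gt0.
have [F [U [cF oU FA AU mUF]]] := closed_open_regular m A (e / 2) mA e20.
have [K cK mK] := tight m (e / 2) e20.
have mF := measurable_closed _ _ _ cF; have mKK := measurable_compact _ _ _ cK.
have cFK : compact (F `&` K).
  have clK : closed K by apply: (compact_closed _ cK); exact: (@metric_hausdorff R Z).
  by apply: (subclosed_compact (closedI cF clK) cK) => x [].
exists (F `&` K) => //; split; first by move=> x [/FA].
have mUm := measurable_open _ _ _ oU.
apply: (@le_lt_trans _ _ (m ((U `\` F) `|` ~` K))).
  apply: le_measure; rewrite ?inE.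
  - by apply: measurableD => //; exact: measurableI.
  - by apply: measurableU; [exact: measurableD|exact: measurableC].
  - move=> x [/AU Ux nFK]; have [Fx|nFx] := pselect (F x); last by left.
    by right => Kx; apply: nFK.
apply: (@le_lt_trans _ _ (m (U `\` F) + m (~` K))).
  by apply: measureU2; [exact: measurableD|exact: measurableC].
by rewrite (splitr e) EFinD lte_leD// fin_num_measure//; exact: measurableC.
Qed.

Lemma open_outer_regular m A (e : R) : measurable A -> (0 < e)%R ->
  exists2 U : set Z, open U & A `<=` U /\ m (U `\` A) < e%:E.
Proof.
move=> mA e0; have [F [U [cF oU FA AU mUF]]] := closed_open_regular m A e mA e0.
have mF := measurable_closed _ _ _ cF; have mU := measurable_open _ _ _ oU.
exists U => //; split => //; apply: le_lt_trans mUF.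
by apply: le_measure; rewrite ?inE; [exact: measurableD|exact: measurableD|exact: setDS].
Qed.

End regularity.

(** * Extension from rectangles *)

(** An alias of the product, so that the semiring of rectangles does not clash with the product
    sigma-algebra. *)
Definition rectangle_type d1 d2 (T1 : measurableType d1) (T2 : measurableType d2) :=
  (T1 * T2)%type.

Section rectangle_semiring.
Context d1 d2 (T1 : measurableType d1) (T2 : measurableType d2).
Local Notation T := (rectangle_type d1 d2 T1 T2).

HB.instance Definition _ := Pointed.on T.

Let rect : set_system T :=
  [set A `*` B | A in @measurable _ T1 & B in @measurable _ T2].

Let rect0 : rect set0.
Proof. by exists set0 => //; exists set0 => //; rewrite setX0. Qed.

Let rectI : setI_closed rect.
Proof.
move=> _ _ [A mA [B mB <-]] [C mC [D mD <-]]; exists (A `&` C); first exact: measurableI.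
by exists (B `&` D); [exact: measurableI|rewrite setXI].
Qed.

Let rectD : semi_setD_closed rect.
Proof.
move=> _ _ [A mA [B mB <-]] [C mC [D mD <-]].
exists [set (A `\` C) `*` B; (A `&` C) `*` (B `\` D)]; split.
- exact: finite_set2.
- move=> _ [->|->].
    by exists (A `\` C); [exact: measurableD|exists B].
  by exists (A `&` C); [exact: measurableI|exists (B `\` D); [exact: measurableD|]].
- rewrite bigcup_setU !bigcup_set1; apply/seteqP; split=> [[x y]/=|[x y]/=].
    move=> [[Ax By] CD]; have [Cx|nCx] := pselect (C x); last by left.
    by right; split => //; split => // Dy; apply: CD.
  by case=> [[[Ax nCx] By]|[[Ax Cx] [By nDy]]]; split => // -[].
- move=> X Y [->|->] [->|->] //=.
    by case=> -[x y] [[/= [_ nC] _] [/= [_ Cx] _]].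
  by case=> -[x y] [[/= [_ Cx] _] [/= [_ nC] _]].
Qed.

HB.instance Definition _ :=
  @isSemiRingOfSets.Build default_measure_display T rect rect0 rectI rectD.

Lemma measurable_rectangle (S : set T) : measurable S -> measurable (S : set (T1 * T2)).
Proof. by case=> A mA [B mB <-]; exact: measurableX. Qed.

End rectangle_semiring.

Section rectangle_extension.
Context (R : realType) (Z : pointedCompleteMetricType R).
Hypothesis Zsep : exists D : set Z, countable D /\ dense D.
Variables (mu nu : {finite_measure set (borel Z) -> \bar R}).
Variable G : {content set (borel Z * borel Z)%type -> \bar R}.
Local Open Scope ereal_scope.
Hypothesis Gmu : forall A : set (borel Z), measurable A -> G (A `*` setT) <= mu A.
Hypothesis Gnu : forall B : set (borel Z), measurable B -> G (setT `*` B) <= nu B.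
Local Notation Q := (rectangle_type _ _ (borel Z) (borel Z)).

Definition rectangle_content : set Q -> \bar R := G.

Let rectangle_content_ge0 S : 0 <= rectangle_content S.
Proof. exact: measure_ge0. Qed.

Let rectangle_content_additive : measure_function.semi_additive rectangle_content.
Proof.
move=> F n mF tF mU; apply: measure_semi_additive => // [k|].
  exact: measurable_rectangle.
exact: measurable_rectangle.
Qed.

HB.instance Definition _ := isContent.Build _ Q R rectangle_content
  rectangle_content_ge0 rectangle_content_additive.

(** An error in one coordinate is a strip, which [Gmu] or [Gnu] bounds by a marginal; this transfers
    regularity of the marginals to [G]. *)
Let G_le (A B C D E F : set (borel Z)) : measurable A -> measurable B ->
  measurable C -> measurable D -> measurable E -> measurable F ->
  A `*` B `<=` (C `*` D) `|` ((E `*` setT) `|` (setT `*` F)) ->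
  G (A `*` B) <= G (C `*` D) + (mu E + nu F).
Proof.
move=> mA mB mC mD mE mF sub.
have mCD := measurableX mC mD.
have mET := measurableX mE (@measurableT _ (borel Z)).
have mTF := measurableX (@measurableT _ (borel Z)) mF.
apply: (@le_trans _ _ (G ((C `*` D) `|` ((E `*` setT) `|` (setT `*` F))))).
  apply: le_measure => //; rewrite inE; first exact: measurableX.
  by apply: measurableU => //; exact: measurableU.
apply: le_trans (@measureU2 _ _ _ G _ _ mCD (measurableU _ _ mET mTF)) _.
rewrite leeD2l//; apply: le_trans (@measureU2 _ _ _ G _ _ mET mTF) _.
by apply: leeD; [exact: Gmu|exact: Gnu].
Qed.

(* Shrink the covered rectangle to a compact one, enlarge the covering ones to open
   ones, and extract a finite subcover. *)
Lemma rectangle_content_subadditive :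
  measurable_subset_sigma_subadditive rectangle_content.
Proof.
move=> _ F mF [A mA [B mB <-]] sub; apply/lee_addgt0Pr => e e0.
have /choice[AB ABP] n : exists AB : set (borel Z) * set (borel Z),
    [/\ measurable AB.1, measurable AB.2 & F n = AB.1 `*` AB.2].
  by have [C mC [D mD <-]] := mF n; exists (C, D).
(* One quarter each for [A] outside [K], [B] outside [L], the total enlargement by the [U n], and
   that by the [V n]. *)
pose e4 : R := (e / 4)%R; have e40 : (0 < e4)%R by rewrite divr_gt0.
have e4n n : (0 < e4 / (2 ^ n.+1)%:R)%R by rewrite divr_gt0// ltr0n expn_gt0.
have [K cK [KA mK]] := compact_inner_regular _ _ Zsep mu A e4 mA e40.
have [L cL [LB mL]] := compact_inner_regular _ _ Zsep nu B e4 mB e40.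
have /choice[U UP] n : exists U : set Z, [/\ open U, (AB n).1 `<=` U &
    mu (U `\` (AB n).1) < (e4 / (2 ^ n.+1)%:R)%:E].
  have [m1 m2 _] := ABP n.
  by have [U oU [AU mU]] := open_outer_regular _ _ mu (AB n).1 _ m1 (e4n n); exists U.
have /choice[V VP] n : exists V : set Z, [/\ open V, (AB n).2 `<=` V &
    nu (V `\` (AB n).2) < (e4 / (2 ^ n.+1)%:R)%:E].
  have [m1 m2 _] := ABP n.
  by have [V oV [AV mV]] := open_outer_regular _ _ nu (AB n).2 _ m2 (e4n n); exists V.
have mKm := measurable_compact _ _ _ cK; have mLm := measurable_compact _ _ _ cL.
have mU n : measurable (U n : set (borel Z)) by apply: measurable_open; have [] := UP n.
have mV n : measurable (V n : set (borel Z)) by apply: measurable_open; have [] := VP n.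
pose W n : set (Z * Z) := U n `*` V n.
have oW n : open (W n).
  rewrite openE => -[x y] [/= Ux Vy]; exists (U n, V n) => //=; split.
    by apply: open_nbhs_nbhs; split => //; have [] := UP n.
  by apply: open_nbhs_nbhs; split => //; have [] := VP n.
have KLW : K `*` L `<=` cover setT W.
  move=> [x y] [/= /KA Ax /LB By]; have [n _] := sub (x, y) (conj Ax By).
  have [_ _ ->] := ABP n => -[/= ABx ABy]; exists n => //; split => /=.
    by have [_ + _] := UP n; exact.
  by have [_ + _] := VP n; exact.
have cKL : compact (K `*` L : set (Z * Z)) by exact: compact_setX.
(* The near-covering form of compactness yields one [N] such that the first [N] open rectangles
   cover [K * L]. *)
move: cKL; rewrite compact_near_coveringP.
move=> /(_ nat \oo (fun n z => exists2 i, (i < n)%N & W i z) _)[|N _ NP].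
  move=> z /KLW[i _ Wi]; exists (W i, [set n | (i < n)%N]) => /=.
    by split; [exact: open_nbhs_nbhs|exists i.+1].
  by move=> [x n] [/= Wx ni]; exists i.
have KLN z : (K `*` L) z -> exists2 i, (i < N)%N & W i z by exact: (NP N (leqnn N)).
have GKL : G (K `*` L) <= \sum_(i < N) G (W i).
  apply: (@content_subadditive _ _ _ G _ W N) => [k _||].
  - exact: measurableX.
  - exact: measurableX.
  - by move=> z /KLN[i iN Wi]; rewrite -bigcup_mkord; exists i.
have GW n : G (W n) <= G (F n) + (e4 + e4)%R%:E * ((2 ^ n.+1)%:R^-1)%:E.
  have [m1 m2 ->] := ABP n.
  apply: (@le_trans _ _ (G ((AB n).1 `*` (AB n).2) +
      (mu (U n `\` (AB n).1) + nu (V n `\` (AB n).2)))).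
    apply: G_le => //; [exact: measurableD|exact: measurableD|].
    move=> [x y] [/= Ux Vy].
    have [Ax|nAx] := pselect ((AB n).1 x); last by right; left.
    have [Bx|nBx] := pselect ((AB n).2 y); last by right; right.
    by left.
  rewrite leeD2l// -EFinM mulrDl EFinD; apply: leeD; apply: ltW.
    by have [] := UP n.
  by have [] := VP n.
have e2 : (0 <= e4 + e4)%R by rewrite addr_ge0// ltW.
have GKLF : G (K `*` L) <= \sum_(0 <= n <oo) G (F n) + (e4 + e4)%:E.
  apply: le_trans GKL _.
  apply: (@le_trans _ _ (\sum_(0 <= i < N) (G (F i) + ((e4 + e4) / (2 ^ i.+1)%:R)%:E))).
    by rewrite big_mkord; apply: lee_sum => i _; exact: GW.
  apply: (@le_trans _ _ (\sum_(0 <= i <oo) (G (F i) + ((e4 + e4) / (2 ^ i.+1)%:R)%:E))).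
    apply: nneseries_lim_ge => n _ _; apply: adde_ge0 => //.
    by rewrite lee_fin divr_ge0.
  exact: (@epsilon_trick R (fun n => G (F n)) (e4 + e4)%R xpredT).
apply: (@le_trans _ _ (G (K `*` L) + (mu (A `\` K) + nu (B `\` L)))).
  apply: G_le => //; [exact: measurableD|exact: measurableD|].
  move=> [x y] [/= Ux Vy].
  have [Ax|nAx] := pselect (K x); last by right; left.
  have [Bx|nBx] := pselect (L y); last by right; right.
  by left.
have -> : e%:E = (e4 + e4)%:E + (e4%:E + e4%:E).
  by rewrite -!EFinD; congr EFin; rewrite /e4; lra.
rewrite [leRHS]addeA; apply: leeD => //.
by apply: leeD; exact: ltW.
Qed.

HB.instance Definition _ := Content_SigmaSubAdditive_isMeasure.Build _ R Q
  rectangle_content rectangle_content_subadditive.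

(** Caratheodory extension of the content on rectangles. Since [G] need not be countably additive on
    the whole sigma-algebra, agreement is asserted on rectangles only. *)
Lemma rectangle_extension :
  exists alpha : {finite_measure set (borel Z * borel Z)%type -> \bar R},
    forall A B : set (borel Z), measurable A -> measurable B ->
      alpha (A `*` B) = G (A `*` B).
Proof.
pose m := measure_extension rectangle_content.
(* The identity carries the measure from the sigma-algebra generated by rectangles to the product
   one. *)
pose f : g_sigma_algebraType (@measurable _ Q) -> (borel Z * borel Z)%type := fun x => x.
have mf : measurable_fun setT f.
  by move=> _ S; rewrite setTI measurable_prod_measurableType.
pose a' : {measure set (borel Z * borel Z)%type -> \bar R} := pushforward m f.
pose a := a' mf.
have aE A B : measurable A -> measurable B -> a (A `*` B) = G (A `*` B).
  move=> mA mB; rewrite /a/= /pushforward /m /measure_extension.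
  rewrite (@measurable_mu_extE _ _ _ rectangle_content)//.
  by exists A => //; exists B.
have afin : fin_num_fun a.
  apply: lty_fin_num_fun; rewrite -setXTT aE//.
  by apply: le_lt_trans (Gmu _ (@measurableT _ _)) _; rewrite ltey_eq fin_num_measure.
pose b : {finite_measure set (borel Z * borel Z)%type -> \bar R} :=
  HB.pack_for {finite_measure set (borel Z * borel Z)%type -> \bar R}
    (Measure.sort a) (Measure_isFinite.Build _ _ _ (Measure.sort a) afin).
by exists b.
Qed.

End rectangle_extension.

(** * The dual functional *)

Lemma indic_sfunE (d : measure_display) (T : measurableType d) (R : realType)
    (A : set T) (mA : measurable A) x :
  (indic_sfun A mA : {sfun T >-> R}) x = (x \in A)%:R.
Proof. by rewrite /= /measurable_realfun.mindic indicE. Qed.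

(** * Integrals of simple functions and a discrete layer-cake bound *)

Section sfun_integral.
Context d (T : measurableType d) (R : realType).
Variable m : {finite_measure set T -> \bar R}.
Implicit Types f g : {sfun T >-> R}.

Lemma sfun_integrable f : m.-integrable setT (EFin \o f).
Proof.
apply: measurable_bounded_integrable => //.
- by rewrite ltey_eq fin_num_measure.
- exact: simple_bounded.
Qed.

Definition sint f : R := \int[m]_x f x.

Lemma sintD f g : sint (f + g) = sint f + sint g.
Proof. by rewrite /sint -RintegralD//; exact: sfun_integrable. Qed.

Lemma le_sint f g : (forall x, f x <= g x) -> sint f <= sint g.
Proof. by move=> fg; apply: le_Rintegral => //; exact: sfun_integrable. Qed.

Lemma sint_scale k f : sint (scale_sfun k f) = sint f * k.
Proof. by rewrite /sint -RintegralZr//; exact: sfun_integrable. Qed.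

Lemma sint_cst (c : R) : sint (cst_sfun c) = c * fine (m setT).
Proof. by rewrite /sint Rintegral_cst. Qed.

Lemma sint0 : sint 0 = 0.
Proof. by apply: (addrI (sint 0)); rewrite -sintD !addr0. Qed.

Lemma sintN f : sint (- f) = - sint f.
Proof. by apply: (addrI (sint f)); rewrite -sintD !subrr sint0. Qed.

Lemma sint_ge0 f : (forall x, 0 <= f x) -> 0 <= sint f.
Proof. by move=> f0; rewrite -sint0; exact: le_sint. Qed.

Lemma sint_indic (A : set T) (mA : measurable A) : sint (indic_sfun A mA) = fine (m A).
Proof. by rewrite /sint /Rintegral/= integral_indic// setIT. Qed.

Lemma sint_sum n (f : 'I_n -> {sfun T >-> R}) : sint (\sum_i f i) = \sum_i sint (f i).
Proof.
by elim/big_rec2: _ => [|i _ g _ <-]; [exact: sint0|rewrite sintD].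
Qed.

(** The sum counts the integers from [1] to [n] that do not exceed [t]. *)
Lemma sum_levels n (t : R) : 0 <= t -> \sum_(k < n) (k.+1%:R <= t)%R%:R <= t.
Proof.
move=> t0; elim: n => [|n ih]; first by rewrite big_ord0.
have [nt|tn] := leP n.+1%:R t.
  apply: le_trans nt; rewrite -[leRHS]mulr1 mulr_natl -[in leRHS](card_ord n.+1) -sumr_const.
  by apply: ler_sum => i _; rewrite lern1 leq_b1.
by rewrite big_ord_recr/= (lt_geF tn) addr0.
Qed.

Lemma measurable_sfun_ge f (c : R) : measurable [set x | c <= f x].
Proof.
rewrite (_ : [set x | _] = f @^-1` `[c, +oo[%classic).
  by rewrite -[X in measurable X]setTI; exact: measurable_funP.
by apply/seteqP; split => x /=; rewrite in_itv/= andbT.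
Qed.

(** Integrate [sum_levels] at [(n + 1) f x]. There are [n] levels against a factor [n + 1]; the
    discrepancy vanishes in the limit taken in [dual_near_ge]. *)
Lemma sum_levels_le_sint f n : (forall x, 0 <= f x) ->
  \sum_(k < n) fine (m [set x | k.+1%:R / n.+1%:R <= f x]) <= sint f *+ n.+1.
Proof.
move=> f0.
pose L (k : nat) : {sfun T >-> R} :=
  indic_sfun _ (measurable_sfun_ge f (k.+1%:R / n.+1%:R)).
rewrite (eq_bigr (fun k : 'I_n => sint (L k))); last by move=> k _; rewrite sint_indic.
rewrite -sint_sum -mulr_natr -sint_scale; apply: le_sint => x.
rewrite sfun_sum /=; apply: le_trans (sum_levels n _ _); last by rewrite mulr_ge0.
apply: ler_sum => k _; rewrite indic_sfunE ler_nat.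
by rewrite -ler_pdivrMr//; case: (boolP (x \in _)) => //; rewrite inE => /= ->.
Qed.

End sfun_integral.

(** * The dual problem and the content it produces *)

Section dual.
Context d1 d2 (T1 : measurableType d1) (T2 : measurableType d2) (R : realType).
Variables (mu : {finite_measure set T1 -> \bar R}) (nu : {finite_measure set T2 -> \bar R}).
Hypothesis mu_le_nu : fine (mu setT) <= fine (nu setT).
Implicit Types (h : {sfun (T1 * T2)%type >-> R}) (f : {sfun T1 >-> R}) (g : {sfun T2 >-> R}).

(** Only [g] has a sign constraint: a free [f] enforces equality of the first marginal with [mu],
    while [g >= 0] enforces only domination of the second by [nu]. *)
Definition admissible h f g :=
  (forall y, 0 <= g y) /\ forall x y, h (x, y) <= f x + g y.

Definition dual_cost f g : R := sint _ _ _ mu f + sint _ _ _ nu g.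

Definition dual h : R :=
  inf [set r | exists f g, admissible h f g /\ dual_cost f g = r].

(* Transferring the infimum [c >= 0] of [g] to [f] costs [c (mu T1 - nu T2) <= 0]. *)
Lemma dual_shift f g : (forall y, 0 <= g y) -> (forall x y, 0 <= f x + g y) ->
  exists f' g', [/\ forall x, 0 <= f' x, forall y, 0 <= g' y,
    forall x y, f' x + g' y = f x + g y & dual_cost f' g' <= dual_cost f g].
Proof.
move=> g0 fg0; pose c := inf (range g).
have hlb : has_lbound (range g) by exists 0 => _ [y _ <-].
have hne : (range g) !=set0 by exists (g point); exists point.
have c0 : 0 <= c by apply: lb_le_inf => // _ [y _ <-].
exists (f + cst_sfun c), (g + cst_sfun (- c)); split.
- move=> x /=; rewrite -lerBlDl sub0r; apply: lb_le_inf => // _ [y _ <-].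
  by rewrite -subr_ge0 opprK addrC.
- by move=> y /=; rewrite subr_ge0; apply: ge_inf => //; exists y.
- by move=> x y /=; rewrite addrACA subrr addr0.
- rewrite /dual_cost !sintD !sint_cst.
  by have := ler_wpM2l c0 mu_le_nu; lra.
Qed.

Lemma dual_cost_ge0 f g : (forall y, 0 <= g y) -> (forall x y, 0 <= f x + g y) ->
  0 <= dual_cost f g.
Proof.
move=> g0 fg0; have [f' [g' [f'0 g'0 _ le]]] := dual_shift f g g0 fg0.
by apply: le_trans le; rewrite addr_ge0// sint_ge0.
Qed.

Lemma sfun_bounded (d : measure_display) (T : measurableType d) (k : {sfun T >-> R}) :
  exists2 M : R, 0 <= M & forall x, `|k x| <= M.
Proof.
have [M [_ MP]] := simple_bounded k; exists (`|M| + 1) => [|x]; first by rewrite addr_ge0.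
by apply: MP => //; rewrite ltr_pwDr// ler_norm.
Qed.

(** Adding a bound [M] of [|h|] to [f] makes [f x + g y] nonnegative, and such a pair has
    nonnegative cost. *)
Lemma dual_lbound h : has_lbound [set r | exists f g, admissible h f g /\ dual_cost f g = r].
Proof.
have [M M0 MP] := sfun_bounded _ _ h.
exists (- (M * fine (mu setT))) => _ [f [g [[g0 hfg] <-]]].
rewrite -subr_ge0 opprK.
have : 0 <= dual_cost (f + cst_sfun M) g.
  apply: dual_cost_ge0 => // x y.
  have -> : (f + cst_sfun M) x + g y = f x + g y - - M by rewrite opprK addrAC.
  rewrite subr_ge0 (le_trans _ (hfg x y))//.
  by have := MP (x, y); rewrite ler_norml => /andP[].
by rewrite /dual_cost sintD sint_cst; lra.
Qed.

Lemma dual_le h f g : admissible h f g -> dual h <= dual_cost f g.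
Proof. by move=> a; apply: ge_inf; [exact: dual_lbound|exists f, g]. Qed.

Lemma dual_ge h c : (forall f g, admissible h f g -> c <= dual_cost f g) -> c <= dual h.
Proof.
move=> hc; apply: lb_le_inf => [|_ [f [g [a <-]]]]; last exact: hc.
have [M M0 MP] := sfun_bounded _ _ h.
exists (dual_cost (cst_sfun M) 0), (cst_sfun M), 0; split => //; split => // x y /=.
by rewrite addr0; apply: le_trans (MP _); exact: ler_norm.
Qed.

Lemma sfun_mulrn (d : measure_display) (T : measurableType d) (k : {sfun T >-> R}) n x :
  (k *+ n) x = k x *+ n.
Proof. by elim: n => [|n ih]; rewrite ?mulr0n// !mulrS -ih. Qed.

Lemma dual_sublinear : sublinear R _ dual.
Proof.
split=> [h h'|h n].
  rewrite -lerBlDr; apply: dual_ge => f g [g0 hfg]; rewrite lerBlDr -lerBlDl.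
  apply: dual_ge => f' g' [g'0 hfg']; rewrite lerBlDl.
  have -> : dual_cost f g + dual_cost f' g' = dual_cost (f + f') (g + g').
    by rewrite /dual_cost !sintD addrACA.
  apply: dual_le; split => [y|x y] /=; first by rewrite addr_ge0.
  by rewrite addrACA; exact: lerD.
apply: dual_ge => f g [g0 hfg].
(* For multiplicity [0] the pair dominates the zero function and its cost is nonnegative, by the
   comparison of masses; a positive multiplicity is divided out. *)
case: n hfg => [|n] hfg; first by rewrite mulr0n dual_cost_ge0.
rewrite -mulr_natr -ler_pdivlMr//.
have -> : dual_cost f g / n.+1%:R = dual_cost (scale_sfun n.+1%:R^-1 f) (scale_sfun n.+1%:R^-1 g).
  by rewrite /dual_cost !sint_scale mulrDl.
apply: dual_le; split => [y|x y] /=; first by rewrite mulr_ge0.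
by rewrite -mulrDl ler_pdivlMr// mulr_natr -sfun_mulrn.
Qed.

(** Applied to [- h], this makes an additive functional below [dual] positive. *)
Lemma dual_le0 h : (forall z, h z <= 0) -> dual h <= 0.
Proof.
move=> h0; apply: (@le_trans _ _ (dual_cost 0 0)).
  by apply: dual_le; split => // x y /=; rewrite addr0.
by rewrite /dual_cost !sint0 addr0.
Qed.

Section content.
Variable (L : {sfun (T1 * T2)%type >-> R} -> R).
Hypothesis LD : forall x y, L (x + y) = L x + L y.
Hypothesis Ldual : forall h, L h <= dual h.

Let L0 : L 0 = 0.
Proof. by apply: (addrI (L 0)); rewrite -LD !addr0. Qed.

Let LN h : L (- h) = - L h.
Proof. by apply: (addrI (L h)); rewrite -LD !subrr L0. Qed.

Let L_ge0 h : (forall z, 0 <= h z) -> 0 <= L h.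
Proof.
move=> h0; rewrite -oppr_le0 -LN; apply: le_trans (Ldual _) _.
by apply: dual_le0 => z /=; rewrite oppr_le0.
Qed.

(** An indicator is a simple function only along with a proof of measurability, hence the case
    analysis; nonmeasurable sets get the default [0]. *)
Definition dual_content (S : set (T1 * T2)) : \bar R :=
  if pselect (measurable S) is left mS then (L (indic_sfun S mS))%:E else 0%E.

Lemma dual_contentE (S : set (T1 * T2)) (mS : measurable S) :
  dual_content S = (L (indic_sfun S mS))%:E.
Proof.
rewrite /dual_content; case: pselect => // mS'.
by rewrite (Prop_irrelevance mS mS').
Qed.

Let dual_content_ge0 S : (0 <= dual_content S)%E.
Proof.
rewrite /dual_content; case: pselect => // mS; rewrite lee_fin; apply: L_ge0 => z.
by rewrite indic_sfunE.
Qed.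

Let dual_content_additive : measure_function.semi_additive dual_content.
Proof.
have G0 : dual_content set0 = 0%E.
  rewrite (dual_contentE _ measurable0) (_ : indic_sfun _ _ = 0) ?L0//.
  by apply/sfuneqP => z; rewrite indic_sfunE in_set0.
apply/additive2P => // A B mA mB AB0.
rewrite (dual_contentE _ mA) (dual_contentE _ mB) (dual_contentE _ (measurableU _ _ mA mB)).
rewrite -EFinD -LD; congr (L _)%:E; apply/sfuneqP => z.
rewrite sfunD /= !indic_sfunE in_setU.
case: (boolP (z \in A)) => zA /=; last by rewrite add0r.
case: (boolP (z \in B)) => zB /=; last by rewrite addr0.
have : (A `&` B) z by split; exact: set_mem.
by rewrite AB0.
Qed.

HB.instance Definition _ := isContent.Build _ _ R dual_content
  dual_content_ge0 dual_content_additive.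

(** Test the dual with the pairs [(1_A, 0)] and [(- 1_A, 0)]; the second is admissible because [f]
    may be negative. *)
Lemma dual_content_fst (A : set T1) : measurable A -> dual_content (A `*` setT) = mu A.
Proof.
move=> mA; have mAT := measurableX mA (@measurableT _ T2).
rewrite (dual_contentE _ mAT) -[RHS]fineK ?fin_num_measure//; congr EFin.
rewrite -(sint_indic _ _ _ mu A mA); apply/eqP; rewrite eq_le; apply/andP; split.
  apply: le_trans (Ldual _) _.
  apply: (@le_trans _ _ (dual_cost (indic_sfun A mA) 0)).
    apply: dual_le; split => // x y; rewrite !indic_sfunE/= addr0 ler_nat.
    by case: (boolP ((x, y) \in _)) => // /[1!inE] -[/= Ax _]; rewrite mem_set.
  by rewrite /dual_cost sint0 addr0.
rewrite -lerN2 -LN -sintN; apply: le_trans (Ldual _) _.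
apply: (@le_trans _ _ (dual_cost (- indic_sfun A mA) 0)).
  apply: dual_le; split => // x y; rewrite !sfunN /= addr0 lerN2.
  rewrite -!/(indic_sfun _ _ _) !indic_sfunE ler_nat.
  by case: (boolP (x \in A)) => // /[1!inE] Ax; rewrite mem_set.
by rewrite /dual_cost sint0 addr0.
Qed.

Lemma dual_content_snd (B : set T2) : measurable B -> (dual_content (setT `*` B) <= nu B)%E.
Proof.
move=> mB; have mTB := measurableX (@measurableT _ T1) mB.
rewrite (dual_contentE _ mTB) -[leRHS]fineK ?fin_num_measure// lee_fin.
rewrite -(sint_indic _ _ _ nu B mB); apply: le_trans (Ldual _) _.
apply: (@le_trans _ _ (dual_cost 0 (indic_sfun B mB))).
  apply: dual_le; split => [y|x y]; rewrite !indic_sfunE//= add0r ler_nat.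
  by case: (boolP ((x, y) \in _)) => // /[1!inE] -[/= _ By]; rewrite mem_set.
by rewrite /dual_cost sint0 add0r.
Qed.

End content.

(* By Hahn-Banach, the dual value of a set is attained by a finitely additive sub-coupling. *)
Lemma dual_attained (S : set (T1 * T2)) (mS : measurable S) :
  exists G : {content set (T1 * T2)%type -> \bar R},
    [/\ forall A, measurable A -> G (A `*` setT) = mu A,
        forall B, measurable B -> (G (setT `*` B) <= nu B)%E &
        G S = (dual (indic_sfun S mS))%:E].
Proof.
have [L [LD Ldual LS]] := hahn_banach_additive _ _ _ (indic_sfun S mS) dual_sublinear.
pose G : {content set (T1 * T2)%type -> \bar R} := dual_content L.
exists (G LD Ldual); split.
- exact: dual_content_fst.
- exact: dual_content_snd.
- by rewrite /= (dual_contentE _ _ mS) LS.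
Qed.

End dual.

(** * Couplings and the Prokhorov distance *)

Section strassen.
Context (R : realType) (Z : pointedCompleteMetricType R).
Hypothesis Zsep : exists D : set Z, countable D /\ dense D.
Local Notation dist := (@rdist R Z).
Local Open Scope ereal_scope.

(** The rectangles are products of balls of radius [1/(k+1)] around dense points whose distance
    exceeds [e + 2/(k+1)], enumerated by [pickle]; indices that fail the test give empty
    rectangles. *)
Lemma far_pairs_bigcup (e : R) : exists A B : nat -> set (borel Z),
  [/\ forall n, measurable (A n), forall n, measurable (B n) &
      far_pairs Z e = \bigcup_n (A n `*` B n)].
Proof.
have [u uP] := dense_seq _ _ Zsep.
pose ok (t : nat * nat * nat) : bool :=
  (e + 2 * t.2.+1%:R^-1 < dist (u t.1.1) (u t.1.2))%R.
pose ctr (i k : nat) : set (borel Z) := thickening R Z [set u i] k.+1%:R^-1.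
pose rect (n : nat) : set (borel Z) * set (borel Z) :=
  if (unpickle n : option (nat * nat * nat)) is Some t then
    if ok t then (ctr t.1.1 t.2, ctr t.1.2 t.2) else (set0, set0) else (set0, set0).
have mctr i k : measurable (ctr i k) by apply: measurable_open; exact: open_thickening.
exists (fun n => (rect n).1), (fun n => (rect n).2); split.
- move=> n; rewrite /rect; case: (unpickle n) => [t|]; last exact: measurable0.
  by case: (ok t); [exact: mctr|exact: measurable0].
- move=> n; rewrite /rect; case: (unpickle n) => [t|]; last exact: measurable0.
  by case: (ok t); [exact: mctr|exact: measurable0].
- apply/seteqP; split=> [[x y] /= exy|[x y] [n _]].
  + have {}exy : (e < dist x y)%R by [].
    (* Two radii are lost in passing from [x, y] to the centres and two more in the test [ok],
       whence the factor [4]. *)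
    have r0 : (0 < (dist x y - e) / 4)%R by rewrite divr_gt0// subr_gt0.
    have [k _ kr] := near_infty_natSinv_lt (PosNum r0).
    have {}kr : (k.+1%:R^-1 < (dist x y - e) / 4)%R := kr k (leqnn k).
    have k0 : (0 < (k.+1%:R^-1 : R))%R by rewrite invr_gt0.
    have [i ix] := uP x _ k0; have [j jy] := uP y _ k0.
    have okt : ok (i, j, k).
      rewrite /ok /=; move: (k.+1%:R^-1)%R kr k0 ix jy => c kr c0 ix jy.
      have := rdist_triangle _ _ x (u i) y; have := rdist_triangle _ _ (u i) (u j) y.
      by rewrite (rdist_sym _ _ x (u i)); lra.
    exists (pickle (i, j, k)) => //; rewrite /rect pickleK okt; split => /=.
      by exists (u i) => //; rewrite rdist_sym.
    by exists (u j) => //; rewrite rdist_sym.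
  + rewrite /rect; case: unpickle => [[[i j] k]|[]//]; case: ifPn => [|_ []//].
    rewrite /ok /= => okt [[_ /= -> xi] [_ /= -> yj]].
    change (is_true (e < dist x y)%R); move: okt xi yj.
    move: (k.+1%:R^-1)%R => c okt xi yj.
    have := rdist_triangle _ _ (u i) x (u j); have := rdist_triangle _ _ x y (u j).
    by rewrite (rdist_sym _ _ (u i) x); lra.
Qed.

Lemma measurable_far_pairs (e : R) : measurable (far_pairs Z e).
Proof.
have [A [B [mA mB ->]]] := far_pairs_bigcup e.
by apply: bigcupT_measurable => n; exact: measurableX.
Qed.

Lemma measurable_enlargement_compact (K : set Z) (e : R) : compact K ->
  measurable (enlargement K e : set (borel Z)).
Proof.
move=> cK; rewrite -bigcap_thickening_compact//; apply: bigcap_measurableType => n _.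
by apply: measurable_open; exact: open_thickening.
Qed.

Variables (mu nu : {finite_measure set (borel Z) -> \bar R}) (e : R).

(** The bounds at radii [e' > e] pass to the limit because the open thickenings of a compact set
    decrease to its closed enlargement. *)
Lemma compact_enlargement_le (K : set Z) :
  (forall e' : R, (e < e')%R -> forall A : set Z, closed A ->
     nu A <= outer_meas mu (enlargement A e') + e'%:E) ->
  compact K -> nu K <= mu (enlargement K e) + e%:E.
Proof.
move=> H cK; apply/lee_addgt0Pr => r r0.
have mE := measurable_enlargement_compact K e cK.
pose S n : set (borel Z) := thickening R Z K (e + n.+1%:R^-1).
have [||| n Sn] := @nonincreasing_measure_lt _ _ _ mu S (mu (enlargement K e) + (r / 2)%:E).
- by move=> n; apply: measurable_open; exact: open_thickening.
- move=> i j ij; apply/subsetPset; apply: thickening_le.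
  by rewrite lerD2l lef_pV2 ?posrE// ler_nat.
- by rewrite bigcap_thickening_compact// lteDl ?fin_num_measure// lte_fin divr_gt0.
(* The first bound keeps the enlargement of radius [e + c] inside [S n]; the second limits the
   additive error to [r / 2]. *)
pose c : R := Num.min (n.+1%:R^-1 / 2)%R (r / 2)%R.
have c0 : (0 < c)%R by rewrite lt_min !divr_gt0// invr_gt0.
have cn : (c < n.+1%:R^-1)%R.
  by rewrite gt_min ltr_pdivrMr// ltr_pMr ?invr_gt0// ltr1n.
have cr : (c <= r / 2)%R by rewrite ge_min lexx orbT.
have clK : closed K by apply: (compact_closed _ cK); exact: (@metric_hausdorff R Z).
apply: le_trans (H (e + c)%R _ K clK) _; first by rewrite ltrDl.
apply: (@le_trans _ _ (mu (S n) + (e + c)%:E)).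
  apply: leeD => //; apply: ereal_inf_lbound; exists (S n) => //; split.
    by apply: measurable_open; exact: open_thickening.
  by move=> x [a Ka xa]; exists a => //; rewrite (le_lt_trans xa)// ltrD2l.
apply: (@le_trans _ _ (mu (enlargement K e) + (r / 2)%:E + (e + c)%:E)).
  by rewrite leeD2r// ltW.
rewrite -!addeA; apply: leeD => //; rewrite -!EFinD lee_fin.
by move: c cr {c0 cn} => c; lra.
Qed.

Hypothesis mass_le : mu setT <= nu setT.
Hypothesis compactH : forall K : set Z, compact K -> nu K <= mu (enlargement K e) + e%:E.

(** Where [g y < t], each [x] within [e] of [y] satisfies [f x >= 1 - g y > s]. So a compact set
    inside the complement of [Q] has its enlargement inside [P], and [compactH] applies. *)
Let level_le (f g : {sfun (borel Z) >-> R}) (s t : R) :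
  (forall x y, (dist x y <= e)%R -> (1 <= f x + g y)%R) -> (s + t = 1)%R ->
  (fine (nu setT) - e <= fine (mu [set x | s <= f x]%R) + fine (nu [set y | t <= g y]%R))%R.
Proof.
move=> fg1 st; set P := [set x | _]; set Q := [set y | _].
have mP : measurable P by exact: measurable_sfun_ge.
have mQ : measurable Q by exact: measurable_sfun_ge.
have nuQ : fine (nu setT) = (fine (nu Q) + fine (nu (~` Q)))%R.
  rewrite -fineD ?fin_num_measure//; last exact: measurableC.
  by rewrite -measureU ?setUv ?setICr//; exact: measurableC.
suff : (fine (nu (~` Q)) <= fine (mu P) + e)%R by rewrite nuQ; lra.
apply/ler_addgt0Pr => r r0.
have mCQ : measurable (~` Q) by exact: measurableC.
have [K cK [KQ mK]] := compact_inner_regular _ _ Zsep nu (~` Q) r mCQ r0.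
have mKm := measurable_compact _ _ _ cK.
rewrite -lee_fin !EFinD !fineK ?fin_num_measure//.
apply: (@le_trans _ _ (nu K + r%:E)).
  rewrite (measureDI nu mCQ mKm) addeC; apply: leeD; last exact: ltW.
  by rewrite setIC setIidl.
rewrite leeD2r//; apply: le_trans (compactH K cK) _; rewrite leeD2r//.
apply: le_measure; rewrite ?inE//; first exact: measurable_enlargement_compact.
move=> x [y Ky xy]; have := KQ _ Ky; rewrite /Q/P/=.
move=> /negP; rewrite -ltNge => gt.
have := fg1 x y xy; move: (f x) (g y) gt => a b; lra.
Qed.

Lemma dual_near_ge (mS : measurable (~` far_pairs Z e)) :
  (fine (nu setT) - e <= dual _ _ _ _ _ mu nu (indic_sfun (~` far_pairs Z e) mS))%R.
Proof.
have mass : (fine (mu setT) <= fine (nu setT))%R.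
  by rewrite fine_le// fin_num_measure.
apply: dual_ge => // f g [g0 hfg].
(* The layer-cake bound needs both functions nonnegative. *)
have [x y|f' [g' [f'0 g'0 E le]]] := dual_shift _ _ _ _ _ mu nu mass f g g0.
  by rewrite (le_trans _ (hfg x y))// indic_sfunE.
apply: le_trans le; set D := dual_cost _ _ _ _ _ _ _ _ _.
have fg1 x y : (dist x y <= e)%R -> (1 <= f' x + g' y)%R.
  move=> xy; rewrite E (le_trans _ (hfg x y))// indic_sfunE mem_set//.
  by apply/negP; rewrite -leNgt.
pose c := (fine (nu setT) - e)%R.
have step n : (c *+ n <= D *+ n.+1)%R.
  rewrite /D /dual_cost [leRHS]mulrnDl.
  have hf := sum_levels_le_sint _ _ _ mu f' n f'0.
  have hg := sum_levels_le_sint _ _ _ nu g' n g'0.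
  apply: (le_trans _ (lerD hf hg)).
  (* Reversing the levels of [f'] pairs [(n - i)/(n + 1)] with [(i + 1)/(n + 1)], which sum to
     [1]. *)
  rewrite [X in (_ <= X + _)%R](reindex_inj rev_ord_inj) -big_split/=.
  rewrite -[in leLHS](card_ord n) -sumr_const; apply: ler_sum => i _.
  apply: level_le => //; rewrite -mulrDl -natrD subnSK// addnS subnK//; last exact: ltnW.
  by rewrite divff.
(* If [D < c], then [n (c - D) <= D] for all [n], against the Archimedean property. *)
rewrite leNgt; apply/negP => Dc.
have cD0 : (0 < c - D)%R by rewrite subr_gt0.
have x0 : (0 <= `|D| / (c - D))%R by rewrite divr_ge0// ltW.
have := archi_boundP x0; have := step (Num.bound (`|D| / (c - D))%R).
move: (Num.bound _) => n; rewrite ltr_pdivrMr// mulrS -(mulr_natr c) -(mulr_natr D) mulrBr => cn.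
rewrite ltNge => /negP; apply; apply: le_trans _ (ler_norm D).
by rewrite lerBlDr ![(n%:R * _)%R]mulrC.
Qed.

End strassen.

(** * Contents that agree on rectangles *)

Section content_bigsetU.
Context d1 d2 (T1 : measurableType d1) (T2 : measurableType d2) (R : realType).
Local Open Scope ereal_scope.

Lemma finite_contentU d (T : measurableType d) (m : {content set T -> \bar R})
    (A B : set T) : m setT < +oo -> measurable A -> measurable B ->
  m (A `|` B) = m A + (m B - m (A `&` B)).
Proof.
move=> mT mA mB; have AB : A `|` B = A `|` (B `\` A) by rewrite setUDr setDv setD0.
rewrite AB measureU ?setDIK//; last exact: measurableD.
rewrite measureD ?(setIC A)//; apply: le_lt_trans mT.
by apply: le_measure; rewrite ?inE.
Qed.

(* Inclusion-exclusion, adding the rectangles one by one. *)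
Lemma eq_content_bigsetU (m1 m2 : {content set (T1 * T2)%type -> \bar R})
    (A : nat -> set T1) (B : nat -> set T2) n :
  (forall n, measurable (A n)) -> (forall n, measurable (B n)) ->
  m1 setT < +oo ->
  (forall C D, measurable C -> measurable D -> m1 (C `*` D) = m2 (C `*` D)) ->
  m1 (\big[setU/set0]_(i < n) (A i `*` B i)) = m2 (\big[setU/set0]_(i < n) (A i `*` B i)).
Proof.
move=> mA mB m1T m12; pose F n := \big[setU/set0]_(i < n) (A i `*` B i).
have m2T : m2 setT < +oo by rewrite -setXTT -m12// setXTT.
have mF k : measurable (F k) by apply: bigsetU_measurable => i _; exact: measurableX.
(* Intersecting with an arbitrary rectangle strengthens the induction: the overlap of [F n] with the
   next rectangle is then of the same form. *)
suff FE C D : measurable C -> measurable D ->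
    m1 ((C `*` D) `&` F n) = m2 ((C `*` D) `&` F n).
  by have := FE _ _ measurableT measurableT; rewrite setXTT setTI.
elim: n C D => [|n ih] C D mC mD; first by rewrite /F big_ord0 setI0 !measure0.
have mCD := measurableX mC mD; have mABn := measurableX (mA n) (mB n).
have FS : (C `*` D) `&` F n.+1 =
    ((C `*` D) `&` F n) `|` ((C `&` A n) `*` (D `&` B n)).
  by rewrite {1}/F big_ord_recr/= setIUr setXI.
have mI := measurableX (measurableI _ _ mC (mA n)) (measurableI _ _ mD (mB n)).
have mCF : measurable ((C `*` D) `&` F n) by exact: measurableI.
have FI : (C `*` D) `&` F n `&` ((C `&` A n) `*` (D `&` B n)) =
    ((C `&` A n) `*` (D `&` B n)) `&` F n.
  by rewrite setXI setIACA setIid [F n `&` _]setIC setIA.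
rewrite FS !finite_contentU// FI ih// ih; [|exact: measurableI|exact: measurableI].
by rewrite m12//; exact: measurableI.
Qed.

End content_bigsetU.

(** * From the dual bound to couplings, and back *)

Section coupling.
Context (R : realType) (Z : pointedCompleteMetricType R).
Hypothesis Zsep : exists D : set Z, countable D /\ dense D.
Local Notation dist := (@rdist R Z).
Local Open Scope ereal_scope.
Implicit Types (mu nu : {finite_measure set (borel Z) -> \bar R}) (e : R).
Local Notation coupling := {finite_measure set (borel Z * borel Z)%type -> \bar R}.

(** The content attaining the dual value of the near pairs leaves at most [mu(Z) - (nu(Z) - e)] for
    the far pairs; its extension from rectangles inherits this bound. *)
Lemma strassen mu nu e : mu setT <= nu setT ->
  (forall K : set Z, compact K -> nu K <= mu (enlargement K e) + e%:E) ->
  exists alpha : coupling,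
    [/\ forall A, measurable A -> alpha (A `*` setT) = mu A,
        forall B, measurable B -> alpha (setT `*` B) <= nu B &
        alpha (far_pairs Z e) <= mu setT - (nu setT - e%:E)].
Proof.
move=> mass compactH; have mfar := measurable_far_pairs _ _ Zsep e.
have mnear := measurableC mfar.
have fmass : (fine (mu setT) <= fine (nu setT))%R by rewrite fine_le// fin_num_measure.
have [G [Gmu Gnu Gnear]] := dual_attained _ _ _ _ _ mu nu fmass _ mnear.
have [|//|alpha aG] := rectangle_extension _ _ Zsep mu nu G.
  by move=> A mA; rewrite Gmu.
exists alpha; split => [A mA|B mB|]; first by rewrite aG// Gmu.
  by rewrite aG// Gnu.
have aT : alpha setT < +oo by rewrite ltey_eq fin_num_measure.
have GT : G setT = mu setT by rewrite -setXTT Gmu.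
have [A [B [mA mB farE]]] := far_pairs_bigcup _ _ Zsep e.
pose W i := A i `*` B i; pose F n := \big[setU/set0]_(i < n) W i.
have mF n : measurable (F n) by apply: bigsetU_measurable => i _; exact: measurableX.
have FE : \bigcup_n F n = far_pairs Z e.
  rewrite farE; apply/seteqP; split=> [z [n _]|z [n _ zn]].
    by rewrite /F -bigcup_mkord => -[i _ zi]; exists i.
  by exists n.+1 => //; rewrite /F big_ord_recr; right.
(* [alpha] and [G] agree on finite unions of rectangles. Only monotonicity of [G] and continuity
   from below of [alpha] are then used, so the limit gives an inequality. *)
have aF n : alpha (F n) <= G (far_pairs Z e).
  have -> : alpha (F n) = G (F n) by exact: eq_content_bigsetU.
  apply: le_measure; rewrite ?inE//.
  by rewrite -FE => z zn; exists n.
have afar : alpha (far_pairs Z e) <= G (far_pairs Z e).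
  have cF : alpha (F n) @[n --> \oo] --> alpha (far_pairs Z e).
    rewrite -FE; apply: nondecreasing_cvg_mu => //; first by rewrite FE.
    by move=> i j ij; apply/subsetPset; exact: subset_bigsetU.
  rewrite -(cvg_lim _ cF)//; apply: lime_le; first by apply/cvg_ex; eexists; exact: cF.
  exact: nearW.
apply: le_trans afar _.
have -> : far_pairs Z e = setT `\` ~` far_pairs Z e by rewrite setTD setCK.
rewrite measureD//; last by rewrite GT ltey_eq fin_num_measure.
rewrite setTI GT; apply: leeB => //; rewrite Gnear.
rewrite -[nu setT]fineK ?fin_num_measure// -EFinB lee_fin.
exact: dual_near_ge.
Qed.

Lemma open_msupportC mu : open (~` msupport mu).
Proof.
apply/open_metricP => x /existsNP[U /not_implyP[oU /not_implyP[Ux /negP mU]]].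
have [r r0 rU] := (open_metricP _ _ U).1 oU x Ux; exists r => // y /rU Uy.
by move=> /(_ U oU Uy); exact/negP.
Qed.

(** By separability, countably many null balls around dense points cover the complement of the
    support; [N] enumerates them, with the empty set for balls that are not null. *)
Lemma msupportC_eq0 mu : mu (~` msupport mu) = 0.
Proof.
have [u uP] := dense_seq _ _ Zsep.
pose ctr (i k : nat) : set (borel Z) := thickening R Z [set u i] k.+1%:R^-1.
have mctr i k : measurable (ctr i k) by apply: measurable_open; exact: open_thickening.
pose N (n : nat) : set (borel Z) :=
  if (unpickle n : option (nat * nat)) is Some t then
    if mu (ctr t.1 t.2) == 0 then ctr t.1 t.2 else set0 else set0.
have mN n : measurable (N n).
  rewrite /N; case: (unpickle n) => [t|]; last exact: measurable0.
  by case: (_ == _); [exact: mctr|exact: measurable0].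
have N0 n : mu (N n) = 0.
  rewrite /N; case: (unpickle n) => [t|]; last exact: measure0.
  by case: eqP => // _; exact: measure0.
apply/eqP; rewrite eq_le measure_ge0 andbT.
apply: (@le_trans _ _ (\sum_(0 <= n <oo) mu (N n))); last by rewrite eseries0.
apply: measure_sigma_subadditive => //.
  by apply: measurable_open; exact: open_msupportC.
move=> x /existsNP[U /not_implyP[oU /not_implyP[Ux /negP mU]]].
have {}mU : mu U = 0 by apply/eqP; rewrite eq_le measure_ge0 andbT leNgt.
have [r r0 rU] := (open_metricP _ _ U).1 oU x Ux.
have r20 : (0 < r / 2)%R by rewrite divr_gt0.
have [k _ kr] := near_infty_natSinv_lt (PosNum r20).
have {}kr : (k.+1%:R^-1 < r / 2)%R := kr k (leqnn k).
have k0 : (0 < (k.+1%:R^-1 : R))%R by rewrite invr_gt0.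
have [i ix] := uP x _ k0.
exists (pickle (i, k)) => //; rewrite /N pickleK /=.
have ctrx : ctr i k x by exists (u i) => //; rewrite rdist_sym.
suff -> : mu (ctr i k) = 0 by rewrite eqxx.
apply: (@subset_measure0 _ _ _ mu _ U) => //; first exact: measurable_open.
move=> y [_ -> yu]; apply: rU; have := rdist_triangle _ _ x (u i) y.
rewrite (rdist_sym _ _ x (u i)) (rdist_sym _ _ (u i) y).
by move: (k.+1%:R^-1)%R kr k0 ix yu => c; lra.
Qed.

Lemma prokhorov_sym mu nu : prokhorov mu nu = prokhorov nu mu.
Proof.
congr ereal_inf; apply/seteqP; split => _ [e [e0 h] <-]; exists e => //; split => // A cA;
  by have [] := h A cA.
Qed.

Lemma enlargement_le (A : set Z) e e' : (e <= e')%R ->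
  enlargement A e `<=` enlargement A e'.
Proof. by move=> ee' x [a Aa xa]; exists a => //; exact: le_trans ee'. Qed.

Lemma le_outer_meas mu (S S' : set Z) : S `<=` S' ->
  outer_meas mu S <= outer_meas mu S'.
Proof.
move=> SS'; apply: le_ereal_inf_tmp => _ [B [mB S'B] <-].
by apply: ereal_inf_lbound; exists B => //; split => //; exact: subset_trans S'B.
Qed.

(** The infimum is not yet known to be attained, hence the strictly larger [e']; an admissible
    radius below [e'] exists and the condition is monotone in the radius. *)
Lemma prokhorov_le mu nu e e' : prokhorov mu nu <= e%:E -> (e < e')%R ->
  forall A : set Z, closed A -> nu A <= outer_meas mu (enlargement A e') + e'%:E.
Proof.
move=> pe ee' A cA.
have : prokhorov mu nu < e'%:E by rewrite (le_lt_trans pe)// lte_fin.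
move=> /ereal_inf_lt[_ [r [r0 h] <-]]; rewrite lte_fin => re'.
apply: le_trans (h A cA).2 _; apply: leeD; last by rewrite lee_fin ltW.
by apply: le_outer_meas; apply: enlargement_le; exact: ltW.
Qed.

Lemma prokhorov_ge0 mu nu : 0 <= prokhorov mu nu.
Proof.
by apply: le_ereal_inf_tmp => _ [e [e0 _] <-]; rewrite lee_fin ltW.
Qed.

Lemma outer_meas_ge0 mu (S : set Z) : 0 <= outer_meas mu S.
Proof. by apply: le_ereal_inf_tmp => _ [B _ <-]. Qed.

Lemma prokhorov_fin_num mu nu : prokhorov mu nu \is a fin_num.
Proof.
rewrite ge0_fin_numE ?prokhorov_ge0//.
(* At this radius the additive term alone dominates either total mass; the [1] keeps it positive. *)
pose r := (fine (mu setT) + fine (nu setT) + 1)%R.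
have mu0 : (0 <= fine (mu setT))%R by exact: fine_ge0.
have nu0 : (0 <= fine (nu setT))%R by exact: fine_ge0.
have le (m m' : {finite_measure set (borel Z) -> \bar R}) (A : set Z) :
    (fine (m setT) <= r)%R -> closed A -> m A <= outer_meas m' (enlargement A r) + r%:E.
  move=> mr cA; apply: (@le_trans _ _ (m setT)).
    by apply: le_measure; rewrite ?inE//; exact: measurable_closed.
  rewrite -[leLHS]fineK ?fin_num_measure// -[leLHS]add0e.
  by apply: leeD; [exact: outer_meas_ge0|rewrite lee_fin].
apply: (@le_lt_trans _ _ r%:E); last by rewrite ltry.
apply: ereal_inf_lbound; exists r => //; split; first by rewrite ltr_wpDl// addr_ge0.
by move=> A cA; split; apply: le => //; rewrite /r; lra.
Qed.

Lemma tv_dist_ge (m1 m2 : set (borel Z) -> \bar R) (A : set (borel Z)) :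
  m1 A \is a fin_num -> m2 A \is a fin_num -> measurable A ->
  m1 A <= m2 A + tv_dist m1 m2 /\ m2 A <= m1 A + tv_dist m1 m2.
Proof.
move=> f1 f2 mA.
have h : `| m1 A - m2 A | <= tv_dist m1 m2 by apply: ereal_sup_ubound; exists A.
split; rewrite -leeBlDl//; apply: le_trans h.
  exact: lee_abs.
by rewrite -[leRHS]abseN oppeB ?fin_num_adde_defl ?fin_numN// addeC; exact: lee_abs.
Qed.

(** Off the far pairs, [p z] in [A] forces [q z] into the enlargement; the two variation terms
    replace the marginals of [alpha] by [m] and [m']. Abstract [p] and [q] cover both orders of the
    projections. *)
Lemma coupling_le_outer (alpha : coupling) (p q : borel Z * borel Z -> borel Z)
    (m m' : {finite_measure set (borel Z) -> \bar R}) e e' (A : set Z) :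
  measurable_fun setT p -> measurable_fun setT q -> closed A ->
  (forall z, (dist z.1 z.2 <= e)%R -> (dist (q z) (p z) <= e')%R) ->
  tv_dist (pushforward alpha p) m + tv_dist (pushforward alpha q) m' +
    alpha (far_pairs Z e) <= e'%:E ->
  m A <= outer_meas m' (enlargement A e') + e'%:E.
Proof.
move=> mp mq cA pq tv; have mA := measurable_closed _ _ _ cA.
rewrite -leeBlDr//; apply: le_ereal_inf_tmp => _ [B [mB AB] <-]; rewrite leeBlDr//.
have mfar := measurable_far_pairs _ _ Zsep e.
have mpA : measurable (p @^-1` A) by rewrite -[X in measurable X]setTI; exact: mp.
have mqB : measurable (q @^-1` B) by rewrite -[X in measurable X]setTI; exact: mq.
have [_ hp] : pushforward alpha p A <= m A + tv_dist (pushforward alpha p) m /\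
    m A <= pushforward alpha p A + tv_dist (pushforward alpha p) m.
  by apply: tv_dist_ge; rewrite ?fin_num_measure// /pushforward fin_num_measure.
have [hq _] : pushforward alpha q B <= m' B + tv_dist (pushforward alpha q) m' /\
    m' B <= pushforward alpha q B + tv_dist (pushforward alpha q) m'.
  by apply: tv_dist_ge; rewrite ?fin_num_measure// /pushforward fin_num_measure.
have hpq : pushforward alpha p A <= pushforward alpha q B + alpha (far_pairs Z e).
  apply: (@le_trans _ _ (alpha (q @^-1` B `|` far_pairs Z e))); last exact: measureU2.
  rewrite /pushforward; apply: le_measure; rewrite ?inE//; first exact: measurableU.
  move=> z Az; have [zfar|znear] := pselect (far_pairs Z e z); first by right.
  by left; apply: (AB (q z)); exists (p z) => //; apply: pq; rewrite leNgt; exact/negP.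
apply: le_trans hp _; apply: le_trans (leeD2r _ hpq) _.
apply: le_trans (leeD2r _ (leeD2r _ hq)) _.
rewrite -!addeA; apply: leeD => //; apply: le_trans tv.
by rewrite addeA addeC addeA.
Qed.

(** Radii in [prokhorov] are positive while [e] may be [0], so the condition is checked at [e + r]
    for every [r > 0]. *)
Lemma prokhorov_le_of_coupling mu nu e (alpha : coupling) :
  discrepancy alpha mu nu + alpha (far_pairs Z e) <= e%:E -> (0 <= e)%R ->
  prokhorov mu nu <= e%:E.
Proof.
move=> He e0; apply/lee_addgt0Pr => r r0; rewrite -EFinD.
apply: ereal_inf_lbound; exists (e + r)%R => //; split; first by rewrite ltr_wpDl.
have {}He : discrepancy alpha mu nu + alpha (far_pairs Z e) <= (e + r)%:E.
  by apply: le_trans He _; rewrite lee_fin lerDl ltW.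
move=> A cA; split.
  apply: (@coupling_le_outer alpha fst snd _ _ e) => //.
  by move=> z ze; rewrite rdist_sym (le_trans ze)// lerDl ltW.
apply: (@coupling_le_outer alpha snd fst _ _ e) => //.
  by move=> z ze; rewrite (le_trans ze)// lerDl ltW.
by rewrite [X in X + _]addeC.
Qed.

(** The deficits [nu - m] on [A] and on its complement are nonnegative and add up to the total
    deficit. *)
Lemma tv_dist_sub (m : {measure set (borel Z) -> \bar R}) nu :
  (forall A, measurable A -> m A <= nu A) -> tv_dist m nu <= nu setT - m setT.
Proof.
move=> mnu; apply: ge_ereal_sup => _ [A mA <-].
have mCA := measurableC mA.
have finnu B : measurable B -> nu B = (fine (nu B))%:E.
  by move=> mB; rewrite fineK ?fin_num_measure.
have finm B : measurable B -> m B = (fine (m B))%:E.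
  move=> mB; rewrite fineK// ge0_fin_numE// (le_lt_trans (mnu _ mB))//.
  by rewrite ltey_eq fin_num_measure.
have -> : nu setT = nu A + nu (~` A) by rewrite -measureU ?setUv ?setICr.
have -> : m setT = m A + m (~` A) by rewrite -measureU ?setUv ?setICr.
have := mnu _ mA; have := mnu _ mCA.
rewrite (finm A)// (finm (~` A))// (finnu A)// (finnu (~` A))//.
move: (fine (m A)) (fine (m (~` A))) (fine (nu A)) (fine (nu (~` A))) => a b c d.
by rewrite !lee_fin ler_norml; lra.
Qed.

Lemma coupling_exists mu nu e : mu setT <= nu setT -> prokhorov mu nu <= e%:E ->
  exists alpha : coupling,
    [/\ discrepancy alpha mu nu + alpha (far_pairs Z e) <= e%:E,
        forall A : set (borel Z), measurable A -> pushforward alpha fst A = mu A,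
        forall A : set (borel Z), measurable A -> pushforward alpha snd A <= nu A &
        alpha (~` (msupport mu `*` msupport nu)) = 0].
Proof.
move=> mass pe; have [K cK|alpha [a1 a2 afar]] := strassen mu nu e mass.
  apply: compact_enlargement_le => // e' ee' A; exact: prokhorov_le pe ee' A.
have {}a1 (A : set (borel Z)) : measurable A -> pushforward alpha fst A = mu A.
  by move=> mA; rewrite -a1// setXT.
have {}a2 (A : set (borel Z)) : measurable A -> pushforward alpha snd A <= nu A.
  by move=> mA; rewrite /pushforward -setTX; exact: a2.
exists alpha; split => //.
- have tv1 : tv_dist (pushforward alpha fst) mu <= 0.
    apply: ge_ereal_sup => _ [A mA <-].
    by rewrite a1// subee ?fin_num_measure// abse0.
  have tv2 : tv_dist (pushforward alpha snd) nu <= nu setT - mu setT.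
    pose m' : {measure set (borel Z) -> \bar R} := pushforward alpha snd.
    have := tv_dist_sub (m' measurable_snd) nu a2.
    by rewrite -(a1 setT).
  rewrite /discrepancy.
  (* The mass excess of [nu] in the discrepancy cancels against the bound on the far pairs, leaving
     [e]. *)
  apply: (@le_trans _ _ (0 + (nu setT - mu setT) + (mu setT - (nu setT - e%:E)))).
    by apply: leeD => //; exact: leeD.
  rewrite add0e -[nu setT]fineK ?fin_num_measure// -[mu setT]fineK ?fin_num_measure//.
  by rewrite -!EFinB -EFinD lee_fin; lra.
- have msup (m : {finite_measure set (borel Z) -> \bar R}) :
      measurable (~` msupport m : set (borel Z)).
    by apply: measurable_open; exact: open_msupportC.
  have mp (A : set (borel Z)) : measurable A ->
      measurable ((fst : borel Z * borel Z -> borel Z) @^-1` A).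
    by move=> mA; rewrite -[X in measurable X]setTI; exact: measurable_fst.
  have mq (A : set (borel Z)) : measurable A ->
      measurable ((snd : borel Z * borel Z -> borel Z) @^-1` A).
    by move=> mA; rewrite -[X in measurable X]setTI; exact: measurable_snd.
  (* The complement is a union of two strips, each null by its marginal. *)
  have -> : ~` (msupport mu `*` msupport nu) =
      fst @^-1` (~` msupport mu) `|` snd @^-1` (~` msupport nu).
    apply/seteqP; split=> [[x y] xy|[x y] [xS|yS] [/= Sx Sy]]; [|exact: xS|exact: yS].
    by have [Sx|nSx] := pselect (msupport mu x); [right => Sy; apply: xy|left].
  apply: null_set_setU; [exact: mp|exact: mq| |].
    by have := a1 _ (msup mu); rewrite msupportC_eq0.
  apply/eqP; rewrite eq_le measure_ge0 andbT -(msupportC_eq0 nu).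
  exact: a2.
Qed.

(** Exchanging the coordinates preserves the far pairs and swaps the two variation terms; this
    reduces (i) to the case where [mu] has the smaller mass. *)
Lemma coupling_swap mu nu e (alpha : coupling) :
  discrepancy alpha nu mu + alpha (far_pairs Z e) <= e%:E ->
  exists beta : coupling, discrepancy beta mu nu + beta (far_pairs Z e) <= e%:E.
Proof.
move=> ae.
pose sw : borel Z * borel Z -> borel Z * borel Z := fun z => (z.2, z.1).
have msw : measurable_fun setT sw by exact: measurable_fun_pair.
pose b' : {measure set (borel Z * borel Z)%type -> \bar R} := pushforward alpha sw.
pose b := b' msw.
have bfin : fin_num_fun b.
  move=> S mS; rewrite /b/= /pushforward fin_num_measure//.
  by rewrite -[X in measurable X]setTI; exact: (msw).
pose beta : coupling := HB.pack_for coupling (Measure.sort b)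
  (Measure_isFinite.Build _ _ _ (Measure.sort b) bfin).
exists beta; apply: le_trans ae; rewrite /discrepancy [X in X + _ <= _]addeC.
apply: leeD => //; rewrite [leLHS]/=/pushforward.
rewrite (_ : sw @^-1` _ = far_pairs Z e)//.
by apply/seteqP; split => -[x y]; rewrite /far_pairs/= metric_sym.
Qed.

End coupling.

Local Open Scope ereal_scope.

Theorem theorem2p1 (R : realType) (Z : pointedCompleteMetricType R)
    (Zsep : exists D : set Z, countable D /\ dense D)
    (mu nu : {finite_measure set (borel Z) -> \bar R}) :
  (* (i) *)
  (forall e : R, (0 <= e)%R ->
     (prokhorov mu nu <= e%:E <->
      exists alpha : {finite_measure set (borel Z * borel Z)%type -> \bar R},
        discrepancy alpha mu nu + alpha (far_pairs Z e) <= e%:E))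
  /\
  (* (ii) *)
  (exists p : R, prokhorov mu nu = p%:E /\ (0 <= p)%R /\
     (exists alpha : {finite_measure set (borel Z * borel Z)%type -> \bar R},
        discrepancy alpha mu nu + alpha (far_pairs Z p) <= p%:E) /\
     (forall e : R, (0 <= e)%R ->
        (exists alpha : {finite_measure set (borel Z * borel Z)%type -> \bar R},
           discrepancy alpha mu nu + alpha (far_pairs Z e) <= e%:E) ->
        (p <= e)%R))
  /\
  (* (iii) *)
  (mu setT <= nu setT ->
   exists alpha : {finite_measure set (borel Z * borel Z)%type -> \bar R},
     discrepancy alpha mu nu + alpha (far_pairs Z (fine (prokhorov mu nu)))
       <= prokhorov mu nu /\
     (forall A : set (borel Z), measurable A -> pushforward alpha fst A = mu A) /\
     (forall A : set (borel Z), measurable A -> pushforward alpha snd A <= nu A) /\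
     alpha (~` (msupport mu `*` msupport nu)) = 0).
Proof.
have iP e : (0 <= e)%R -> (prokhorov mu nu <= e%:E <->
    exists alpha : {finite_measure set (borel Z * borel Z)%type -> \bar R},
      discrepancy alpha mu nu + alpha (far_pairs Z e) <= e%:E).
  move=> e0; split=> [pe|[alpha ae]]; last exact: prokhorov_le_of_coupling ae e0.
  have [mass|/ltW mass] := leP (mu setT) (nu setT).
    by have [alpha [ae _ _ _]] := coupling_exists _ _ Zsep mu nu e mass pe; exists alpha.
  rewrite prokhorov_sym in pe.
  have [alpha [ae _ _ _]] := coupling_exists _ _ Zsep nu mu e mass pe.
  exact: coupling_swap ae.
have pfin := prokhorov_fin_num _ _ mu nu.
have pE : prokhorov mu nu = (fine (prokhorov mu nu))%:E by rewrite fineK.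
have p0 : (0 <= fine (prokhorov mu nu))%R by rewrite fine_ge0// prokhorov_ge0.
split; [exact: iP|split].
  exists (fine (prokhorov mu nu)); split => //; split => //; split.
    by apply/iP => //; rewrite -pE.
  by move=> e e0 /(iP e e0); rewrite {1}pE lee_fin.
move=> mass; have pp : prokhorov mu nu <= (fine (prokhorov mu nu))%:E by rewrite -pE.
have [alpha [ae a1 a2 asupp]] := coupling_exists _ _ Zsep mu nu _ mass pp.
by exists alpha; split; first by rewrite [leRHS]pE.
Qed.
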